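(* If $\pi$ is a virtually polycyclic group, then the characteristic variety $\mathcal{V}^i_1(\pi)$ is finite, for all $i$.
   Context: For a finitely generated group $\pi$, $\mathbb{T}(\pi)=\mathrm{Hom}(\pi,\mathbb{C}^\times)$ is the character torus. For $\rho\in\mathbb{T}(\pi)$, $\mathbb{C}_\rho$ is the right $\pi$-module $\mathbb{C}$ with $z\cdot g=z\rho(g)$. The characteristic varieties are $\mathcal{V}^i_r(\pi)=\{\rho\in\mathbb{T}(\pi):\dim H_i(\pi,\mathbb{C}_\rho)\ge r\}$ (group homology with twisted coefficients). *)

(* Defs.v *)
From HB Require Import structures.
From mathcomp Require Import all_boot all_order all_algebra.
From mathcomp Require Import monoid.
From mathcomp Require Import complex.
From mathcomp Require Import Rstruct.
Set Implicit Arguments.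
Unset Strict Implicit.
Unset Printing Implicit Defensive.
Import Order.TTheory GRing.Theory Num.Theory.
Local Open Scope ring_scope.

Definition CC : Type := complex Rdefinitions.R.

Section Defs.
Variable G : groupType.

Definition is_subgroup (H : G -> Prop) : Prop :=
  H 1%g /\ (forall x y, H x -> H y -> H (x * y)%g) /\ (forall x, H x -> H (x^-1)%g).

Definition finite_index (H : G -> Prop) : Prop :=
  exists s : seq G, forall x, exists2 y, y \in s & H (y^-1 * x)%g.

Definition polycyclic (H : G -> Prop) : Prop :=
  exists (k : nat) (Hs : nat -> G -> Prop),
    (forall x, Hs 0%N x <-> H x) /\
    (forall x, Hs k x <-> x = 1%g) /\
    (forall j, (j <= k)%N -> is_subgroup (Hs j)) /\
    (forall j, (j < k)%N ->
       (forall x, Hs j.+1 x -> Hs j x) /\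
       (forall x y, Hs j x -> Hs j.+1 y -> Hs j.+1 (x^-1 * y * x)%g) /\
       (exists2 g, Hs j g & forall x, Hs j x ->
          exists n : nat, Hs j.+1 ((g ^+ n)^-1 * x)%g \/ Hs j.+1 (g ^+ n * x)%g)).

Definition virtually_polycyclic : Prop :=
  exists H : G -> Prop, is_subgroup H /\ finite_index H /\ polycyclic H.

Definition character (rho : G -> CC) : Prop :=
  (forall g h, rho (g * h)%g = rho g * rho h) /\ (forall g, rho g != 0).

(** ** Group homology with coefficients in ℂ_rho, via the (inhomogeneous) bar
    complex C_n = ℂ_rho ⊗_{ℤG} B_n, which is the ℂ-vector space with basis
    the n-tuples [g_1|...|g_n] (represented as seq G of size n), and
    ∂[g_1|...|g_n] = rho(g_1)[g_2|...|g_n]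
                     + Σ_{i=1}^{n-1} (-1)^i [g_1|...|g_i g_{i+1}|...|g_n]
                     + (-1)^n [g_1|...|g_{n-1}]
    (using z ⊗ g_1[g_2|...] = z·g_1 ⊗ [g_2|...] = z rho(g_1) ⊗ [g_2|...]).
    A chain is a finite formal ℂ-linear combination, represented as a list
    of (coefficient, basis tuple) pairs; two chains are equal iff they have
    the same coefficient function [chain_coef]. *)
Definition chain := seq (CC * seq G).

Definition chain_coef (c : chain) (t : seq G) : CC :=
  \sum_(p <- c | p.2 == t) p.1.

Definition merge_at (s : seq G) (i : nat) : seq G :=
  (* i ranges over 1..n-1: replace g_i, g_{i+1} by g_i g_{i+1} *)
  take i.-1 s ++ (nth 1%g s i.-1 * nth 1%g s i)%g :: drop i.+1 s.

Definition bd_gen (rho : G -> CC) (s : seq G) : chain :=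
  match s with
  | [::] => [::]
  | g :: t =>
      (rho g, t) ::
      [seq ((-1) ^+ i, merge_at s i) | i <- iota 1 (size s).-1] ++
      [:: ((-1) ^+ size s, take (size s).-1 s)]
  end.

Definition bd (rho : G -> CC) (c : chain) : chain :=
  flatten [seq [seq (p.1 * q.1, q.2) | q <- bd_gen rho p.2] | p <- c].

Definition is_chain_of_degree (n : nat) (c : chain) : bool :=
  all (fun p => size p.2 == n) c.

Definition is_cycle (rho : G -> CC) (c : chain) : Prop :=
  forall t, chain_coef (bd rho c) t = 0.

Definition homology_dim_ge (rho : G -> CC) (n r : nat) : Prop :=
  exists zs : seq chain,
    size zs = r /\
    (forall j, (j < r)%N -> is_chain_of_degree n (nth [::] zs j)) /\
    (forall j, (j < r)%N -> is_cycle rho (nth [::] zs j)) /\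
    (forall (a : nat -> CC) (w : chain), is_chain_of_degree n.+1 w ->
       (forall t, \sum_(j < r) a j * chain_coef (nth [::] zs j) t
                  = chain_coef (bd rho w) t) ->
       forall j, (j < r)%N -> a j = 0).

Definition char_variety (i r : nat) (rho : G -> CC) : Prop :=
  character rho /\ homology_dim_ge rho i r.

End Defs.

(* Main.v *)
Require Import Defs.
From mathcomp Require Import all_boot monoid.
From mathcomp Require Import all_order all_algebra.
From mathcomp Require Import complex Rstruct.
From mathcomp Require Import boolp classical_sets functions.
From mathcomp Require Import ring.
Set Implicit Arguments.
Unset Strict Implicit.
Unset Printing Implicit Defensive.
Import GRing.Theory Num.Theory.
Local Open Scope ring_scope.

(** Group homology H_i(G, C_rho) is detected by cohomology: a non-bounding cycle
    is separated from the boundaries by a linear functional, and such functionals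
    are cocycles with values in C_rho.  For cohomology one goes up a polycyclic
    series, showing at each stage N that H^*(N, C_rho) is finite dimensional for
    every character rho of N and non-zero for finitely many rho only.

    If N has finite index in N', averaging over cosets embeds H^*(N') into H^*(N),
    and a character of N' has finitely many possible values on each coset
    representative once its restriction to N is known.  If N'/N is infinite cyclic
    generated by t, the Wang sequence bounds H^*(N') by the kernel and the cokernel
    of (rho(t) tau - 1) on H^*(N), tau being the translation by t; so
    H^*(N', C_rho) = 0 unless H^*(N, C_rho) <> 0 and 1/rho(t) is one of the
    finitely many eigenvalues of tau. *)

(** * Quotients of vector spaces by subspaces *)

Section QuotientDimension.
Variable K : fieldType.

Section Subspace.
Variable E : lmodType K.
Implicit Types (U V B : E -> Prop) (u v : E).

Definition subspace U := U 0 /\ forall a u v, U u -> U v -> U (a *: u + v).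

Lemma subspace0 U : subspace U -> U 0.
Proof. by case. Qed.

Lemma subspaceZ U a u : subspace U -> U u -> U (a *: u).
Proof. by move=> [U0 UD] Uu; rewrite -[a *: u]addr0; apply: UD. Qed.

Lemma subspaceD U u v : subspace U -> U u -> U v -> U (u + v).
Proof. by move=> [_ UD] Uu Uv; rewrite -[u]scale1r; apply: UD. Qed.

Lemma subspaceN U u : subspace U -> U u -> U (- u).
Proof. by move=> sU Uu; rewrite -scaleN1r; apply: subspaceZ. Qed.

Lemma subspaceB U u v : subspace U -> U u -> U v -> U (u - v).
Proof. by move=> sU Uu Uv; apply: subspaceD => //; apply: subspaceN. Qed.

Lemma subspace_sum U (I : Type) (r : seq I) (P : pred I) (F : I -> E) :
  subspace U -> (forall i, P i -> U (F i)) -> U (\sum_(i <- r | P i) F i).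
Proof.
by move=> sU UF; elim/big_ind: _ => // [|u v]; [case: sU | apply: subspaceD].
Qed.

Definition spans_mod n (e : 'I_n -> E) V B :=
  forall v, V v -> exists c : 'I_n -> K, B (v - \sum_i c i *: e i).

(** Finite-dimensionality of the image of [V] in [E / B], expressed without forming a quotient
    space. *)
Definition findim V B :=
  exists n (e : 'I_n -> E), (forall i, V (e i)) /\ spans_mod e V B.

Lemma findim_trans V U B : subspace B -> (forall u, U u -> V u) ->
  findim V U -> findim U B -> findim V B.
Proof.
move=> sB UV [n [e [Ve he]]] [m [f [Uf hf]]].
exists (n + m)%N, (fun i : 'I_(n + m) =>
  match fintype.split i with inl j => e j | inr j => f j end).
split=> [i|v Vv]; first by case: fintype.split => j; [apply: Ve | apply/UV/Uf].
have [c Uc] := he v Vv; have [c' Bc] := hf _ Uc.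
exists (fun i : 'I_(n + m) => match fintype.split i with inl j => c j | inr j => c' j end).
rewrite big_split_ord /= opprD addrA.
have -> : \sum_(i < n)
   (match fintype.split (lshift m i) with inl j => c j | inr j => c' j end) *:
   (match fintype.split (lshift m i) with inl j => e j | inr j => f j end) = \sum_i c i *: e i.
  by apply: eq_bigr => i _; rewrite (unsplitK (inl i)).
have -> // : \sum_(i < m)
   (match fintype.split (rshift n i) with inl j => c j | inr j => c' j end) *:
   (match fintype.split (rshift n i) with inl j => e j | inr j => f j end) = \sum_i c' i *: f i.
by apply: eq_bigr => i _; rewrite (unsplitK (inr i)).
Qed.

(** A spanning family of minimal length is free: a nontrivial relation would allow one vector to be
    dropped. *)
Lemma findim_basis V B : subspace B -> findim V B ->
  exists n (e : 'I_n -> E), [/\ forall i, V (e i), spans_mod e V B &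
    forall c : 'I_n -> K, B (\sum_i c i *: e i) -> forall i, c i = 0].
Proof.
move=> sB fd.
have exP : exists n, `[< exists e : 'I_n -> E, (forall i, V (e i)) /\ spans_mod e V B >].
  by case: fd => n fd; exists n; apply/asboolP.
case: (ex_minnP exP) => -[|n] /asboolP [e [Ve spe]] nmin.
  by exists 0%N, e; split=> // c _ [].
exists n.+1, e; split=> // c Bc k; apply/eqP/negPn/negP => ck0.
suff /nmin : `[< exists f : 'I_n -> E, (forall i, V (f i)) /\ spans_mod f V B >].
  by rewrite ltnn.
apply/asboolP; exists (fun i => e (lift k i)); split=> // v Vv.
have [b Bb] := spe v Vv.
(* These are the coefficients of [v] once [e k] is eliminated by means of the relation [c]. *)
exists (fun i => b (lift k i) - b k / c k * c (lift k i)).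
have := subspaceD sB (subspaceZ (b k / c k) sB Bc) Bb; congr B.
rewrite addrC -addrA; congr (_ + _); rewrite scaler_sumr.
rewrite (bigD1_ord k) //= [in X in _ + X](bigD1_ord k) //= !scalerA divfK //.
rewrite opprD addrACA addNr add0r addrC -sumrB -sumrN; apply: eq_bigr => i _.
by rewrite scalerA -scalerBl -scaleNr opprB.
Qed.

End Subspace.

(* [R] is a linear relation inducing an injection from [U / B] into [W / B']. *)
Lemma findim_relation (E F : lmodType K) (U B : E -> Prop) (W B' : F -> Prop)
    (R : E -> F -> Prop) :
  subspace U -> subspace B -> subspace B' ->
  (forall a u v w x, R u w -> R v x -> R (a *: u + v) (a *: w + x)) ->
  (forall u, U u -> exists2 w, W w & R u w) ->
  (forall u w, U u -> R u w -> B' w -> B u) ->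
  findim W B' -> findim U B.
Proof.
move=> sU sB sB' RD RW RB [n [e [_ spe]]].
have {spe RW W} : forall u, U u -> exists (c : 'I_n -> K) (b : F),
    B' b /\ R u (\sum_i c i *: e i + b).
  move=> u /RW [w Ww Ruw]; have [c Bc] := spe w Ww.
  by exists c, (w - \sum_i c i *: e i); rewrite addrCA subrr addr0.
elim: n e U sU RB => [|n IH] e U sU RB span.
  exists 0%N, (fun=> 0); split=> [[]//|u Uu].
  have [c [b [Bb Rb]]] := span u Uu; exists c.
  by rewrite big_ord0 subr0; move: Rb; rewrite big_ord0 add0r => Rb; apply: RB Rb _.
(* [U'] collects the elements related, modulo [B'], to the span of all vectors but the last. Either
   it is all of [U], or [U] is [U'] plus the line of some [u0] with nonzero last coordinate. *)
pose e' i := e (widen_ord (leqnSn n) i).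
pose U' u := U u /\ exists (c : 'I_n -> K) b, B' b /\ R u (\sum_i c i *: e' i + b).
have [allU'|] := pselect (forall u, U u -> U' u).
  by apply: (IH e') => // u /allU' [].
move=> /existsNP [u0 /not_implyP [Uu0 nU'u0]].
have [c [b [Bb Rb]]] := span _ Uu0.
have cn0 : c ord_max != 0.
  apply: contra_notN nU'u0 => /eqP c0; split=> //.
  exists (fun i => c (widen_ord (leqnSn n) i)), b; split=> //.
  by move: Rb; rewrite big_ord_recr /= c0 scale0r addr0.
have kill u : U u -> exists k : K, U' (u - k *: u0).
  move=> Uu; have [d [x [Bx Rx]]] := span _ Uu.
  exists (d ord_max / c ord_max); split.
    by apply: subspaceB => //; apply: subspaceZ.
  pose k := d ord_max / c ord_max.
  exists (fun i => - k * c (widen_ord (leqnSn n) i) + d (widen_ord (leqnSn n) i)).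
  exists (- k *: b + x); split; first by case: sB' => _; apply.
  have := RD (- k) _ _ _ _ Rb Rx; rewrite scaleNr [in R _]addrC -/k; congr (R _ _).
  rewrite scalerDr addrACA scaler_sumr -big_split big_ord_recr /=; congr (_ + _).
  rewrite [X in _ + X](_ : _ = 0) ?addr0.
    by apply: eq_bigr => i _; rewrite scalerDl scalerA.
  by rewrite scalerA -scalerDl mulNr divfK // addNr scale0r.
have sU' : subspace U'.
  split=> [|a u v [Uu [c1 [b1 [B1 R1]]]] [Uv [c2 [b2 [B2 R2]]]]].
    have [k] := kill _ Uu0; have := kill 0 (subspace0 sU).
    move=> [k0 [U1 [c1 [b1 [B1 R1]]]]] [_ _]; split; first by case: sU.
    exists (fun=> 0), (0 : F); split; first by case: sB'.
    (* [R 0 0] is obtained by subtracting a related pair from itself. *)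
    have := RD (-1) _ _ _ _ R1 R1; rewrite !scaleN1r !addNr.
    by rewrite big1 ?addr0 // => i _; rewrite scale0r.
  split; first by case: sU => _; apply.
  exists (fun i => a * c1 i + c2 i), (a *: b1 + b2); split; first by case: sB' => _; apply.
  have := RD a _ _ _ _ R1 R2; congr (R _ _).
  rewrite scalerDr addrACA scaler_sumr -big_split /=; congr (_ + _).
  by apply: eq_bigr => i _; rewrite scalerDl scalerA.
have fdU' : findim U' B.
  by apply: (IH e') => // [u w [Uu _]|u []] //; apply: RB.
apply: (@findim_trans _ U U') => // [u []//|].
exists 1%N, (fun=> u0); split=> // u /kill [k Uk]; exists (fun=> k).
by rewrite big_ord1.
Qed.

Section Congruence.
Variables (E : lmodType K) (B : E -> Prop).
Hypothesis sB : subspace B.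

Lemma congr_sym u v : B (u - v) -> B (v - u).
Proof. by move=> /(subspaceN sB); rewrite opprB. Qed.

Lemma congr_trans v u w : B (u - v) -> B (v - w) -> B (u - w).
Proof. by move=> Buv /(subspaceD sB Buv); rewrite addrA subrK. Qed.

Lemma congr_subr u v u' v' : B (u - u') -> B (v - v') -> B ((u - v) - (u' - v')).
Proof.
move=> Bu /(subspaceB sB Bu); congr B.
by rewrite !opprB addrACA [- u' - v]addrC addrACA.
Qed.

Lemma congr_scale a u v : B (u - v) -> B (a *: u - a *: v).
Proof. by rewrite -scalerBr; apply: subspaceZ. Qed.

Lemma congr_sum (I : finType) (F F' : I -> E) :
  (forall i, B (F i - F' i)) -> B (\sum_i F i - \sum_i F' i).
Proof. by move=> BF; rewrite -sumrB; apply: subspace_sum. Qed.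

End Congruence.

(** [T] acts on the image of [V] modulo [B] by a square matrix, and [p] is its characteristic
    polynomial. Away from the eigenvalues [T - mu] is invertible there, hence injective and
    surjective. *)
Lemma regular_mod_findim (E : lmodType K) (V B : E -> Prop) (T : E -> E) :
  subspace V -> subspace B -> (forall a u v, T (a *: u + v) = a *: T u + T v) ->
  (forall v, V v -> V (T v)) -> (forall v, B v -> B (T v)) -> findim V B ->
  exists p : {poly K}, p != 0 /\ forall mu, ~~ root p mu ->
    (forall v, V v -> B (T v - mu *: v) -> B v) /\
    (forall v, V v -> exists2 u, V u & B (v - (T u - mu *: u))).
Proof.
move=> sV sB TD TV TB fd.
have T0 : T 0 = 0 by have := TD (-1) 0 0; rewrite scaler0 addr0 scaleN1r addNr.
have TZ a v : T (a *: v) = a *: T v by rewrite -[a *: v]addr0 TD T0 addr0.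
have TA u v : T (u + v) = T u + T v by rewrite -[u]scale1r TD !scale1r.
have TS n (F : 'I_n -> E) : T (\sum_i F i) = \sum_i T (F i).
  by apply: (big_morph T).
have Tcongr u v : B (u - v) -> B (T u - T v).
  by move=> /TB; rewrite TA -scaleN1r TZ scaleN1r.
have [n [e [Ve spe free]]] := findim_basis sB fd.
have /fin_all_exists [a Ba] i : exists c : 'I_n -> K, B (T (e i) - \sum_j c j *: e j).
  exact/spe/TV/Ve.
(* Coordinates are row vectors, so [T] becomes right multiplication by [A]. *)
pose A : 'M[K]_n := \matrix_(i, j) a i j.
pose comb (r : 'rV[K]_n) := \sum_i r 0 i *: e i.
have combB r r' : comb r - comb r' = comb (r - r').
  by rewrite -sumrB; apply: eq_bigr => i _; rewrite !mxE scalerBl.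
have combZ b r : b *: comb r = comb (b *: r).
  by rewrite scaler_sumr; apply: eq_bigr => i _; rewrite mxE scalerA.
have Tcomb r : B (T (comb r) - comb (r *m A)).
  have -> : comb (r *m A) = \sum_i r 0 i *: \sum_j a i j *: e j.
    under [RHS]eq_bigr do rewrite scaler_sumr.
    rewrite exchange_big; apply: eq_bigr => j _; rewrite mxE scaler_suml.
    by apply: eq_bigr => i _; rewrite mxE scalerA.
  by rewrite TS; apply: congr_sum => // i; rewrite TZ; apply: congr_scale.
have modT mu r : B ((T (comb r) - mu *: comb r) - comb (r *m (A - mu%:M))).
  rewrite mulmxBr mul_mx_scalar -combB -combZ.
  by apply: congr_subr => //; rewrite subrr; apply: subspace0.
have span v : V v -> exists r, B (v - comb r).
  move=> /spe [c Bc]; exists (\row_i c i); congr (B (_ - _)): Bc.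
  by apply: eq_bigr => i _; rewrite mxE.
exists (char_poly A); split; first exact/monic_neq0/char_poly_monic.
move=> mu; rewrite -eigenvalue_root_char => nmu.
have Au : A - mu%:M \in unitmx.
  by rewrite -row_free_unit -kermx_eq0; move: nmu; rewrite /eigenvalue negbK.
split=> v /span [r Br].
  move=> Bv; have : B (comb (r *m (A - mu%:M)) - 0).
    apply: (congr_trans sB) (congr_sym sB (modT mu r)) _.
    apply: (congr_trans sB (v := T v - mu *: v)); last by rewrite subr0.
    have Br' := congr_sym sB Br.
    by apply: (congr_subr sB) (Tcongr _ _ Br') (congr_scale sB _ Br').
  rewrite subr0 => /free r0.
  have {}r0 : r *m (A - mu%:M) = 0 by apply/rowP => j; rewrite r0 mxE.
  have {}r0 : r = 0 by rewrite -[r](mulmxK Au) r0 mul0mx.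
  by move: Br; rewrite r0 /comb big1 ?subr0 // => i _; rewrite mxE scale0r.
exists (comb (r *m invmx (A - mu%:M))).
  by apply: subspace_sum => // i _; apply: subspaceZ.
apply: congr_trans Br (congr_sym _ _) => //.
by have := modT mu (r *m invmx (A - mu%:M)); rewrite mulmxKV.
Qed.

End QuotientDimension.

(** By Zorn there is a maximal subspace [M] containing [B] and avoiding [z]. It is a complement of
    the line of [z], and [phi] is the coordinate along [z]. *)
Lemma separating_functional (K : fieldType) (E : lmodType K) (B : E -> Prop) (z : E) :
  subspace B -> ~ B z ->
  exists phi : E -> K, [/\ forall a u v, phi (a *: u + v) = a * phi u + phi v,
    forall u, B u -> phi u = 0 & phi z = 1].
Proof.
move=> sB nBz.
(* [set0] is allowed because Zorn_bigcup also asks for the union of the empty chain. *)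
pose P (X : set E) := X = set0 \/ [/\ subspace X, forall u, B u -> X u & ~ X z].
have /Zorn_bigcup [M [PM maxM]] : forall F : set (set E), (F `<=` P)%classic ->
    total_on F subset -> P (\bigcup_(X in F) X)%classic.
  move=> F FP Ftot.
  have [[X [FX [x Xx]]]|noX] := pselect (exists X, F X /\ exists x, X x); last first.
    left; rewrite -subset0 => x [X FX Xx]; apply: noX.
    by exists X; split=> //; exists x.
  have sX Y y : F Y -> Y y -> [/\ subspace Y, forall u, B u -> Y u & ~ Y z].
    by move=> FY Yy; case: (FP _ FY) => // Y0; rewrite Y0 in Yy.
  have [sX0 BX nXz] := sX X x FX Xx.
  right; split.
  - split=> [|a u v [Y FY Yu] [Y' FY' Yv]]; first by exists X => //; case: sX0.
    have [YY'|YY'] := Ftot _ _ FY FY'.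
      by exists Y' => //; have [[_ +] _ _] := sX _ _ FY' Yv; apply => //; apply: YY'.
    by exists Y => //; have [[_ +] _ _] := sX _ _ FY Yu; apply => //; apply: YY'.
  - by move=> u Bu; exists X => //; apply: BX.
  - by case=> Y FY Yz; have [_ _ []] := sX _ _ FY Yz.
have {PM} [sM BM nMz] : [/\ subspace M, forall u, B u -> M u & ~ M z].
  case: PM => // M0; case: (maxM B); last by right.
  by rewrite M0; split=> // /(_ 0); apply; case: sB.
have decomp v : exists c : K, M (v - c *: z).
  have [Mv|nMv] := pselect (M v); first by exists 0; rewrite scale0r subr0.
  (* [M'] is [M] plus the line of [v], hence strictly larger than [M]; maximality forces [z] into
     it. *)
  pose M' : set E := fun u => exists a, M (u - a *: v).
  have sM' : subspace M'.
    split; first by exists 0; rewrite scale0r subr0; case: sM.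
    move=> a u w [b Mb] [c Mc]; exists (a * b + c).
    have := sM.2 a _ _ Mb Mc; congr M.
    by rewrite scalerBr scalerA addrACA scalerDl opprD.
  have [a Ma] : M' z.
    apply: contrapT => nM'z; apply: (maxM M'); last first.
      right; split=> // u Bu; exists 0; rewrite scale0r subr0; exact: BM.
    split=> [u Mu|/(_ v) vM]; first by exists 0; rewrite scale0r subr0.
    by apply/nMv/vM; exists 1; rewrite scale1r subrr; case: sM.
  have a0 : a != 0 by apply: contra_notN nMz => /eqP a0; move: Ma; rewrite a0 scale0r subr0.
  exists a^-1; have := subspaceZ (- a^-1) sM Ma; congr M.
  by rewrite scaleNr scalerBr scalerA mulVf // scale1r opprB.
have [phi Mphi] := choice decomp.
have uniqphi v c : M (v - c *: z) -> phi v = c.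
  move=> Mc; apply/eqP; rewrite -subr_eq0; apply: contra_notT nMz => d0.
  have := subspaceZ (phi v - c)^-1 sM (subspaceB sM Mc (Mphi v)); congr M.
  by rewrite opprB [_ + (_ - v)]addrC subrKA -scalerBl scalerA mulVf ?scale1r.
exists phi; split.
- move=> a u v; apply: uniqphi; have := sM.2 a _ _ (Mphi u) (Mphi v); congr M.
  by rewrite scalerBr scalerA addrACA scalerDl opprD.
- by move=> u Bu; apply: uniqphi; rewrite scale0r subr0; apply: BM.
- by apply: uniqphi; rewrite scale1r subrr; case: sM.
Qed.


(** * Equivariant cochains *)

Section Cochains.
Variables (K : fieldType) (G : groupType).
Implicit Types (f h : seq G -> K^o) (rho : G -> K) (N : G -> Prop) (g t x y : G).

(* The homogeneous coboundary [f(x_1, .., x_n) - f(x_0, x_2, ..) + ..], unfolded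
   along the first argument. *)
Fixpoint coboundary_at (s : seq G) f : K^o :=
  if s is x :: s' then f s' - coboundary_at s' (fun u => f (x :: u)) else 0.

Definition coboundary f : seq G -> K^o := fun s => coboundary_at s f.

Lemma coboundary_cons f x s :
  coboundary f (x :: s) = f s - coboundary (fun u => f (x :: u)) s.
Proof. by []. Qed.

Lemma cochainE a f h s : (a *: f + h) s = a * f s + h s.
Proof. by []. Qed.

Lemma coboundary_lin a f h :
  coboundary (a *: f + h) = a *: coboundary f + coboundary h.
Proof.
apply/funext => s; elim: s => [|x s IH] in f h *.
  by rewrite cochainE /coboundary /= mulr0 addr0.
have {}IH := IH (fun u => f (x :: u)) (fun u => h (x :: u)).
rewrite cochainE !coboundary_cons cochainE.
by rewrite (IH : coboundary (fun u => (_ *: f + h) (x :: u)) s = _) cochainE; ring.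
Qed.

Lemma coboundary0 : coboundary 0 = 0.
Proof.
by have := coboundary_lin (-1) 0 0; rewrite scaler0 addr0 scaleN1r addNr.
Qed.

Lemma coboundaryB f h : coboundary (f - h) = coboundary f - coboundary h.
Proof. by rewrite addrC -scaleN1r coboundary_lin scaleN1r addrC. Qed.

Lemma coboundaryZ a f s : coboundary (a *: f) s = a * coboundary f s.
Proof. by rewrite -[a *: f]addr0 coboundary_lin coboundary0 addr0. Qed.

(** With [f_x] for [f] with first argument [x], the recursion reads [(d f)_x = f - d f_x]. So
    [d (d f)] at [x :: s] is [d (d f_x)] at [s], and induction applies. *)
Lemma coboundaryK f : coboundary (coboundary f) = 0.
Proof.
apply/funext => s; elim: s => [|x s IH] // in f *.
rewrite coboundary_cons.
have -> : (fun u => coboundary f (x :: u)) = f - coboundary (fun u => f (x :: u)).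
  by apply/funext => u; rewrite coboundary_cons !fctE.
by rewrite coboundaryB !fctE IH subr0 subrr.
Qed.

(** For [c = rho g] this is the action of [g] on cochains with values in C_rho; a fixed [f]
    satisfies [f (g s) = rho g * f s]. *)
Definition translate (c : K) g f : seq G -> K^o :=
  fun s => c * f [seq (g^-1 * x)%g | x <- s].

Lemma translate_lin c g a f h :
  translate c g (a *: f + h) = a *: translate c g f + translate c g h.
Proof. by apply/funext => s; rewrite cochainE /translate cochainE; ring. Qed.

Lemma coboundary_translate c g f :
  coboundary (translate c g f) = translate c g (coboundary f).
Proof.
apply/funext => s; elim: s => [|x s IH] in f *; first by rewrite /translate /= mulr0.
rewrite coboundary_cons [RHS]/translate map_cons coboundary_cons mulrBr; congr (_ - _).
exact: (IH (fun u => f ((g^-1 * x)%g :: u))).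
Qed.

(** A character of [N] is encoded as a function on all of [G] with arbitrary values outside [N], so
    two characters are only ever compared on [N]. *)
Definition character_on N rho :=
  (forall x y, N x -> N y -> rho (x * y)%g = rho x * rho y) /\
  (forall x, N x -> rho x != 0).

(** Lists of length n + 1 carry degree n. Vanishing on the empty list removes the augmentation term,
    which would otherwise create coboundaries in degree 0. *)
Definition equivariant N rho f :=
  f [::] = 0 /\
  forall g s, N g -> f [seq (g * x)%g | x <- s] = rho g * f s.

(* All degrees are treated at once: [cocycles / coboundaries] is the product of
   the groups H^n(N, C_rho), computed from the free resolution of G. *)
Definition cocycles N rho f := equivariant N rho f /\ coboundary f = 0.

Definition coboundaries N rho f := exists2 h, equivariant N rho h & f = coboundary h.

Lemma equivariant_subspace N rho : subspace (equivariant N rho).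
Proof.
split=> [|a f h [f0 fN] [h0 hN]]; first by split=> // g s _; rewrite mulr0.
split=> [|g s Ng]; rewrite !cochainE; first by rewrite f0 h0 mulr0 addr0.
by rewrite fN // hN //; ring.
Qed.

Lemma cocycles_subspace N rho : subspace (cocycles N rho).
Proof.
have [C0 CD] := equivariant_subspace N rho.
split=> [|a f h [Cf df] [Ch dh]]; first by split=> //; apply: coboundary0.
by split; [apply: CD | rewrite coboundary_lin df dh scaler0 addr0].
Qed.

Lemma coboundaries_subspace N rho : subspace (coboundaries N rho).
Proof.
have [C0 CD] := equivariant_subspace N rho.
split=> [|a _ _ [f Cf ->] [h Ch ->]]; first by exists 0; rewrite ?coboundary0.
by exists (a *: f + h); [apply: CD | rewrite coboundary_lin].
Qed.

Lemma translate_equivariant N rho c g f :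
  (forall x, N x -> N (g^-1 * x * g)%g /\ rho (g^-1 * x * g)%g = rho x) ->
  equivariant N rho f -> equivariant N rho (translate c g f).
Proof.
move=> norm [f0 fN]; split=> [|x s Nx]; first by rewrite /translate /= f0 mulr0.
rewrite /translate -map_comp; have [Ngx rgx] := norm x Nx.
have -> : [seq ((fun y => g^-1 * y) \o (fun y => x * y))%g y | y <- s] =
    [seq (g^-1 * x * g * y)%g | y <- [seq (g^-1 * y)%g | y <- s]].
  by rewrite -map_comp; apply: eq_map => y /=; rewrite -!mulgA mulVKg.
by rewrite fN // rgx mulrCA.
Qed.

Lemma eq_equivariant N rho sigma f : (forall x, N x -> rho x = sigma x) ->
  equivariant N rho f -> equivariant N sigma f.
Proof. by move=> e [f0 fN]; split=> // g s Ng; rewrite -e // fN. Qed.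

Lemma eq_cocycles N rho sigma f : (forall x, N x -> rho x = sigma x) ->
  cocycles N rho f -> cocycles N sigma f.
Proof. by move=> e [Cf df]; split=> //; apply: eq_equivariant Cf. Qed.

Lemma eq_coboundaries N rho sigma f : (forall x, N x -> rho x = sigma x) ->
  coboundaries N rho f -> coboundaries N sigma f.
Proof. by move=> e [h Ch fE]; exists h => //; apply: eq_equivariant Ch. Qed.

Lemma cocycles_restrict N N' rho f : (forall x, N x -> N' x) ->
  cocycles N' rho f -> cocycles N rho f.
Proof. by move=> NN' [[f0 fN] df]; split=> //; split=> // g s /NN'; apply: fN. Qed.

Definition gexpz t (k : int) := match k with Posz n => t ^+ n | Negz n => t ^- n.+1 end%g.

Lemma gexpzS t k : gexpz t (k + 1) = (t * gexpz t k)%g.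
Proof.
case: k => [n|[|n]]; first by rewrite -PoszD addn1 /= expgS.
  by rewrite /= expg1 mulgV.
have -> : Negz n.+1 + 1 = Negz n by rewrite !NegzE -[n.+2]addn1 PoszD opprD addrNK.
by rewrite /= [(t ^+ n.+2)%g]expgSr invgM mulVKg.
Qed.

Lemma gexpzB1 t k : gexpz t (k - 1) = (t^-1 * gexpz t k)%g.
Proof. by rewrite -{2}[k](subrK 1) gexpzS mulKg. Qed.

Lemma gexpzD t j k : gexpz t (j + k) = (gexpz t j * gexpz t k)%g.
Proof.
elim/int_rect: j => [|n IH|n IH]; first by rewrite add0r mul1g.
  by rewrite -[n.+1]addn1 PoszD addrAC gexpzS IH gexpzS mulgA.
by rewrite -[n.+1]addn1 PoszD opprD addrAC gexpzB1 IH gexpzB1 mulgA.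
Qed.

End Cochains.

(** * Extensions by an infinite cyclic group *)

Section InfiniteCyclicQuotient.
Variables (K : fieldType) (G : groupType) (N N' : G -> Prop) (t : G).
Implicit Types (x y : G) (f h : seq G -> K^o).
Hypotheses (sN : is_subgroup N) (sN' : is_subgroup N').
Hypothesis (NN' : forall x, N x -> N' x).
Hypothesis (normN : forall x y, N' x -> N y -> N (x^-1 * y * x)%g).
Hypothesis (N't : N' t).
Hypothesis (quotN : forall x, N' x -> exists k : int, N (gexpz t (- k) * x)%g).
Hypothesis (freeN : forall k : int, N (gexpz t k) -> k = 0).

Lemma normN_conj x y : N' x -> N y -> N (x * y * x^-1)%g.
Proof. by move=> N'x /(normN (sN'.2.2 _ N'x)); rewrite invgK. Qed.

Lemma gexpz_in k : N' (gexpz t k).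
Proof.
have [N1 [NM NV]] := sN'.
have tn n : N' (t ^+ n)%g by elim: n => [//|n IH]; rewrite expgS; apply: NM.
by case: k => n //=; apply: NV.
Qed.

(** On each right coset of [N'] in [G], identified with [N'] by a base point, [lev] is the
    projection to [N' / N], which is the group of integers. *)
Lemma exists_level : exists lev : G -> int,
  (forall x y, N x -> lev (x * y)%g = lev y) /\ (forall y, lev (t * y)%g = lev y + 1).
Proof.
have [N'1 [N'M N'V]] := sN'; have [N1 [NM NV]] := sN.
(* The base point is chosen from the coset [N' x] itself, so it depends only on that coset. *)
pose r x := xget 1%g (fun y => N' (x * y^-1)%g).
have N'r x : N' (x * (r x)^-1)%g.
  by apply: (@xgetPex _ 1%g (fun y => N' (x * y^-1)%g)); exists x; rewrite mulgV.
have rM x y : N' x -> r (x * y)%g = r y.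
  move=> N'x; congr xget; apply/funext => z; apply/propext.
  rewrite -mulgA; split=> H; last exact: N'M.
  by rewrite -(mulKg x (y * z^-1)%g); apply: N'M => //; apply: N'V.
pose L x (k : int) := N (gexpz t (- k) * (x * (r x)^-1))%g.
pose lev x := xget 0 (L x).
have levP x : L x (lev x) by apply: xgetPex; apply: quotN.
have Luniq x j k : L x j -> L x k -> j = k.
  move=> Lj Lk; have := NM _ _ Lj (NV _ Lk).
  rewrite invgM mulgA mulgK => H; apply/eqP; rewrite eq_sym -subr_eq0; apply/eqP/freeN.
  rewrite -[k]opprK addrC; move: H; congr N; rewrite opprK gexpzD; congr (_ * _)%g.
  by apply/eqP; rewrite eqg_invLR -mulg_eq1 -gexpzD addNr.
exists lev; split=> [x y Nx|y].
  congr xget; apply/funext => k; apply/propext; rewrite /L (rM x y (NN' Nx)).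
  have -> : (gexpz t (- k) * (x * y * (r y)^-1) =
      (gexpz t (- k) * x * (gexpz t (- k))^-1) * (gexpz t (- k) * (y * (r y)^-1)))%g.
    by rewrite -!mulgA mulKg.
  have Nc := normN_conj (gexpz_in (- k)) Nx.
  split=> H; last exact: NM.
  by have := NM _ _ (NV _ Nc) H; rewrite mulKg.
apply: (Luniq (t * y)%g); first exact: levP.
move: (levP y); rewrite /L rM // opprD gexpzB1; congr N.
have E : gexpz t (- lev y) = (t^-1 * gexpz t (- lev y) * t)%g.
  have tc : gexpz t (- lev y + 1) = (gexpz t (- lev y) * t)%g by rewrite gexpzD.
  by rewrite -mulgA -tc gexpzS mulKg.
by rewrite {1}E -!mulgA.
Qed.

Section Twisted.
Variable rho : G -> K.
Hypothesis rhoN' : character_on N' rho.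
Let T := @translate K G (rho t) t.
Let T' := @translate K G (rho t)^-1 t^-1%g.

Lemma character1 : rho 1%g = 1.
Proof.
have [N'1 _] := sN'; have [rM r0] := rhoN'.
by apply: (mulfI (r0 _ N'1)); rewrite -rM // mul1g mulr1.
Qed.

Lemma characterV x : N' x -> rho (x^-1)%g = (rho x)^-1.
Proof.
move=> N'x; have [N'1 [_ N'V]] := sN'; have [rM r0] := rhoN'.
by apply: (mulfI (r0 _ N'x)); rewrite -rM ?mulfV ?mulgV ?character1 //; auto.
Qed.

Lemma character_conj x y : N' x -> N y -> rho (x^-1 * y * x)%g = rho y.
Proof.
move=> N'x Ny; have [N'1 [N'M N'V]] := sN'; have [rM r0] := rhoN'.
rewrite !rM ?characterV //; auto.
by rewrite mulrAC mulVf ?mul1r ?r0.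
Qed.

Lemma equivariant_translate c x f : N' x ->
  equivariant N rho f -> equivariant N rho (translate c x f).
Proof.
move=> N'x; apply: translate_equivariant => y Ny.
by split; [apply: normN | apply: character_conj].
Qed.

Lemma translateVK f : T (T' f) = f.
Proof.
apply/funext => s; rewrite /T /T' /translate mulrA mulfV ?rhoN'.2 // mul1r.
by rewrite -map_comp map_id_in // => x _ /=; rewrite invgK mulVKg.
Qed.

(* H^1(N'/N, -) vanishes on the module of N-equivariant cochains, which is coinduced:
   solve the recursion along the levels of a coset of N'. *)
Lemma translate_sub1_surj f : equivariant N rho f ->
  exists2 h, equivariant N rho h & T h - h = f.
Proof.
move=> Cf; have [lev [levN levS]] := exists_level.
have sC := equivariant_subspace N rho.
have CT n : equivariant N rho (iter n T f).
  by elim: n => //= n IH; apply: equivariant_translate.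
have CT' n : equivariant N rho (iter n T' f).
  by elim: n => //= n IH; apply: equivariant_translate => //; apply: sN'.2.2.
(* [m] solves [T (m (k - 1)) = m k + f] with [m 0 = 0], forwards with powers of [T] and backwards
   with powers of its inverse; [Negz n] stands for -(n + 1). *)
pose m k : seq G -> K^o := match k with
  | Posz n => - \sum_(j < n) iter j T f
  | Negz n => \sum_(j < n.+1) iter j.+1 T' f
  end.
have Cm k : equivariant N rho (m k).
  by case: k => n; [apply: subspaceN | ] => //; apply: subspace_sum.
have mS k : T (m (k - 1)) = m k + f.
  have TS n (F : 'I_n -> seq G -> K^o) : T (\sum_i F i) = \sum_i T (F i).
    apply: (big_morph T) => [a b|]; last by apply/funext => s; rewrite /T /translate mulr0.
    by rewrite -[a]scale1r /T translate_lin !scale1r.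
  have TN a : T (- a) = - T a.
    by apply/funext => s; rewrite /T /translate -mulrN.
  case: k => [[|n]|n].
  - rewrite (_ : 0%:Z - 1 = Negz 0) //= big_ord0 oppr0 add0r TS big_ord1 /=.
    exact: translateVK.
  - rewrite (_ : n.+1%:Z - 1 = Posz n); last by rewrite -[n.+1]addn1 PoszD addrK.
    by rewrite /= TN TS big_ord_recl /= opprD addrAC addNr add0r.
  - rewrite (_ : Negz n - 1 = Negz n.+1); last by rewrite !NegzE -opprD -PoszD addn1.
    rewrite /m TS big_ord_recl /= translateVK addrC; congr (_ + _).
    by apply: eq_bigr => i _; rewrite translateVK.
(* The level of the first argument selects the cochain. Translation by [t] lowers that level by one,
   which turns the recursion for [m] into the required equation. *)
exists (fun s => if s is x :: _ then m (lev x) s else 0).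
  split=> // g [|x s] Ng; first by rewrite /= mulr0.
  rewrite map_cons levN // -map_cons; exact: (Cm _).2.
apply/funext => -[|x s]; first by rewrite !fctE /T /translate /= mulr0 subr0 Cf.1.
rewrite !fctE {1}/T /translate map_cons.
have -> : lev (t^-1 * x)%g = lev x - 1.
  by apply/eqP; rewrite eq_sym subr_eq -levS mulVKg.
rewrite -map_cons -[X in X - _]/(T (m (lev x - 1)) (x :: s)) mS !fctE.
by rewrite addrAC subrr add0r.
Qed.

(** If [T h - h = coboundary l], solve [T m - m = l]. Then [h - coboundary m] still bounds [f] and
    is fixed by [T], so it is equivariant under [N] and [t], hence under [N']. *)
Lemma coboundaries_extend f h : cocycles N' rho f -> equivariant N rho h ->
  f = coboundary h -> coboundaries N rho (T h - h) -> coboundaries N' rho f.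
Proof.
move=> [[f0 fN'] df] Ch fh [l Cl Thl].
have [m Cm Tm] := translate_sub1_surj Cl.
have [rM r0] := rhoN'; have [N'1 [N'M N'V]] := sN'.
have sC := equivariant_subspace N rho.
pose h' := h - coboundary m.
have Cdm : equivariant N rho (coboundary m).
  split=> [//|g s Ng]; have := coboundary_translate 1 g^-1%g m => /(congr1 (fun u => u s)).
  rewrite [RHS]/translate mul1r invgK => <-; rewrite -[RHS]/((rho g *: coboundary m) s).
  rewrite -[rho g *: _]addr0 -coboundary0 -coboundary_lin; congr (coboundary _ s).
  by apply/funext => u; rewrite addr0 /translate mul1r invgK; apply: Cm.2.
have Ch' : equivariant N rho h' by apply: subspaceB.
have Th' : T h' = h'.
  apply/eqP; rewrite -subr_eq0; apply/eqP.
  have -> : T h' = T h - coboundary (T m).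
    rewrite coboundary_translate /h' addrC -scaleN1r /T translate_lin scaleN1r addrC //.
  rewrite /h' opprD addrACA Thl -Tm coboundaryB opprK addrACA.
  by rewrite subrr addNr addr0.
have th' s : h' [seq (t * x)%g | x <- s] = rho t * h' s.
  rewrite -{1}Th' /T /translate -map_comp; congr (_ * h' _).
  by rewrite map_id_in // => x _ /=; rewrite mulKg.
have th'z k s : h' [seq (gexpz t k * x)%g | x <- s] = rho (gexpz t k) * h' s.
  have tp n u : h' [seq (t ^+ n * x)%g | x <- u] = rho (t ^+ n)%g * h' u.
    elim: n => [|n IH].
      by rewrite character1 mul1r map_id_in // => x _; rewrite mul1g.
    rewrite expgS rM //; last exact: (gexpz_in n).
    rewrite -mulrA -IH -th' -map_comp; congr h'; apply: eq_map => x /=.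
    by rewrite mulgA.
  case: k => n /=; first exact: tp.
  rewrite characterV; last exact: (gexpz_in n.+1).
  apply: (mulfI (r0 _ (gexpz_in n.+1))); rewrite /= -tp mulVKf ?(r0 _ (gexpz_in n.+1)) //.
  by rewrite -map_comp map_id_in // => x _ /=; rewrite mulVKg.
exists h'; last by rewrite coboundaryB coboundaryK subr0.
split=> [|g s N'g]; first exact: Ch'.1.
have [k Nk] := quotN N'g.
have gE : g = (gexpz t k * (gexpz t (- k) * g))%g.
  by rewrite mulgA -gexpzD subrr /= mul1g.
have -> : [seq (g * x)%g | x <- s] =
   [seq (gexpz t k * x)%g | x <- [seq (gexpz t (- k) * g * x)%g | x <- s]].
  by rewrite -map_comp; apply: eq_map => x /=; rewrite {1}gE !mulgA.
rewrite th'z Ch'.2 // mulrA -rM -?gE //; first exact: gexpz_in.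
exact: NN'.
Qed.

End Twisted.
End InfiniteCyclicQuotient.

(** * Finiteness along a polycyclic series *)

Section FiniteOn.
Variables (K : eqType) (G : groupType).
Implicit Types (P : (G -> K) -> Prop) (S : G -> Prop) (rho sigma : G -> K).

Definition agree S rho sigma := forall x, S x -> rho x = sigma x.

Definition finite_on P S :=
  exists L : list (G -> K), forall rho, P rho ->
    exists2 sigma, List.In sigma L & agree S rho sigma.

(** Each listed function is replaced by a member of [P] with the same restriction to [S], if there
    is one, so that facts about [P] apply to the list. *)
Lemma finite_on_witnesses P S : finite_on P S ->
  exists L : list (G -> K), forall rho, P rho ->
    exists sigma, [/\ List.In sigma L, P sigma & agree S rho sigma].
Proof.
move=> [L HL].
have /choice [c Hc] : forall sigma, exists tau, (exists2 rho, P rho & agree S rho sigma) ->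
    P tau /\ agree S tau sigma.
  move=> sigma; have [[rho Pr ar]|no] := pselect (exists2 rho, P rho & agree S rho sigma).
    by exists rho.
  by exists sigma => /no.
exists (List.map c L) => rho Pr; have [sigma Ls ars] := HL _ Pr.
have [Pc ac] := Hc sigma (ex_intro2 _ _ rho Pr ars).
by exists (c sigma); split=> [||x Sx]; [apply: List.in_map | | rewrite ars // ac].
Qed.

Lemma In_mem (x : K) (s : seq K) : x \in s -> List.In x s.
Proof. by elim: s => //= y s IH; rewrite inE => /orP[/eqP ->|/IH]; auto. Qed.

(** Each restriction to [S] branches into finitely many, one for each possible value at [y]. *)
Lemma finite_on_add P S y : finite_on P S ->
  (forall sigma, P sigma ->
     exists V : seq K, forall rho, P rho -> agree S rho sigma -> rho y \in V) ->
  finite_on P (fun x => S x \/ x = y).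
Proof.
move=> /finite_on_witnesses [L HL] HV.
have /choice [V {}HV] : forall sigma, exists V : seq K, P sigma ->
    forall rho, P rho -> agree S rho sigma -> rho y \in V.
  move=> sigma; have [/HV [V {}HV]|nP] := pselect (P sigma); first by exists V.
  by exists [::] => /nP.
exists (List.flat_map (fun sigma =>
  List.map (fun a x => if x == y then a else sigma x) (V sigma)) L) => rho Pr.
have [sigma [Ls Ps ars]] := HL _ Pr.
exists (fun x => if x == y then rho y else sigma x).
  apply/List.in_flat_map; exists sigma; split=> //.
  apply/List.in_map_iff; exists (rho y); split=> //.
  by apply: In_mem; apply: HV.
by move=> x []; case: eqP => [-> //|nxy]; [apply: ars | move=> /nxy].
Qed.

Lemma finite_on_extend P S S' (ys : seq G) : finite_on P S ->
  (forall y, y \in ys -> forall sigma, P sigma ->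
     exists V : seq K, forall rho, P rho -> agree S rho sigma -> rho y \in V) ->
  (forall rho sigma, P rho -> P sigma -> agree S rho sigma ->
     (forall y, y \in ys -> rho y = sigma y) -> agree S' rho sigma) ->
  finite_on P S'.
Proof.
elim: ys S => [|y ys IH] S fin HV ext.
  have [L HL] := finite_on_witnesses fin; exists L => rho Pr.
  by have [sigma [Ls Ps ars]] := HL _ Pr; exists sigma => //; apply: ext.
apply: (IH (fun x => S x \/ x = y)).
- by apply: finite_on_add => // sigma; apply: HV; rewrite mem_head.
- move=> z ysz sigma Ps; have [|V {}HV] := HV z _ sigma Ps; first by rewrite inE ysz orbT.
  by exists V => rho Pr ar; apply: HV => // x Sx; apply: ar; left.
- move=> rho sigma Pr Ps ar ays; apply: ext => // [x Sx|z]; first by apply: ar; left.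
  by rewrite inE => /orP[/eqP ->|/ays //]; apply: ar; right.
Qed.

End FiniteOn.

Lemma finite_roots (K : closedFieldType) (p : {poly K}) : p != 0 ->
  exists r : seq K, forall x, root p x -> x \in r.
Proof.
have [r pE] := closed_field_poly_normal p; move=> p0; exists r => x.
by rewrite pE rootZ ?lead_coef_eq0 // root_prod_XsubC.
Qed.

(** * Subgroups with finite-dimensional cohomology and finitely many jumps *)

Section Goodness.
Variables (K : numClosedFieldType) (G : groupType).
Implicit Types (N : G -> Prop) (rho sigma : G -> K) (x y g : G).

(** Non-vanishing of H^n(N, C_rho) in at least one degree n. *)
Definition jump N rho := character_on N rho /\
  exists2 f, cocycles N rho f & ~ coboundaries N rho f.

(** The property carried up the series. Finite dimension is included because it bounds the number of
    eigenvalues in the infinite cyclic step. *)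
Definition tame N :=
  (forall rho, character_on N rho -> findim (cocycles N rho) (coboundaries N rho)) /\
  finite_on (jump N) N.

Lemma character_on_sub N N' rho : (forall x, N x -> N' x) ->
  character_on N' rho -> character_on N rho.
Proof. by move=> NN' [rM r0]; split=> [x y /NN' ? /NN'|x /NN']; auto. Qed.

(** Coning with the vertex 1 contracts the complex, leaving the value at [[:: 1]] as the only
    invariant of a class. A character of the trivial group takes the value 1, so one restriction
    occurs. *)
Lemma tame_trivial N : (forall x, N x <-> x = 1%g) -> tame N.
Proof.
move=> N1; have sN : is_subgroup N.
  split; first exact/N1; split=> [x y /N1 -> /N1 ->|x /N1 ->]; apply/N1.
    by rewrite mulg1.
  by rewrite invg1.
split=> [rho /(character1 sN) r1|]; last first.
  exists [:: fun=> 1] => rho [/(character1 sN) r1 _].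
  by exists (fun=> 1) => [|x /N1 ->]; first by left.
apply: (@findim_relation _ _ K^o _ _ (fun=> True) (fun c => c = 0)
  (fun f c => c = f [:: 1%g])).
- exact: cocycles_subspace.
- exact: coboundaries_subspace.
- by split=> // a u v -> ->; rewrite scaler0 addr0.
- by move=> a f h c d -> ->.
- by move=> f _; exists (f [:: 1%g]).
- move=> f c [[f0 _] df] -> f10; exists (fun u => f (1%g :: u)).
    split=> // g s /N1 ->; rewrite r1 mul1r; congr (f (_ :: _)).
    by rewrite map_id_in // => x _; rewrite mul1g.
  apply/funext => s; apply/eqP; rewrite -subr_eq0 -coboundary_cons df.
  exact/eqP.
- exists 1%N, (fun=> 1); split=> // c _; exists (fun=> c).
  by rewrite big_ord1 /GRing.scale /= mulr1 subrr.
Qed.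

(** * Passage to an extension with infinite cyclic quotient *)

Section InfiniteCyclicStep.
Variables (N N' : G -> Prop) (t : G).
Hypotheses (sN : is_subgroup N) (sN' : is_subgroup N').
Hypothesis (NN' : forall x, N x -> N' x).
Hypothesis (normN : forall x y, N' x -> N y -> N (x^-1 * y * x)%g).
Hypothesis (N't : N' t).
Hypothesis (quotN : forall x, N' x -> exists k : int, N (gexpz t (- k) * x)%g).
Hypothesis (freeN : forall k : int, N (gexpz t k) -> k = 0).

Let extend := @coboundaries_extend K G N N' t sN sN' NN' normN N't quotN freeN.

(** The coboundary of [T h - h] is [T f - f], which vanishes because [f] is [N']-equivariant. This
    cocycle is the obstruction to making [h] equivariant under [t]. *)
Lemma cocycles_translate_sub1 rho f h : character_on N' rho -> cocycles N' rho f ->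
  equivariant N rho h -> f = coboundary h ->
  cocycles N rho (translate (rho t) t h - h).
Proof.
move=> rhoN' [[_ fN'] _] Ch fh; split.
  apply: subspaceB => //; first exact: equivariant_subspace.
  exact: (equivariant_translate sN' NN' normN rhoN').
have [N'1 [N'M N'V]] := sN'; have [rM r0] := rhoN'.
rewrite coboundaryB coboundary_translate -fh; apply/eqP.
rewrite subr_eq0; apply/eqP/funext => s.
by rewrite /translate fN' ?(characterV sN' rhoN') ?mulVKf ?r0 //; auto.
Qed.

(** Filter by the kernel [U] of restriction to [N]: the quotient by [U] embeds in the cohomology of
    [N] by restriction, and [U] modulo coboundaries by the obstruction [T h - h]. *)
Lemma findim_infinite_cyclic rho : character_on N' rho ->
  findim (cocycles N rho) (coboundaries N rho) ->
  findim (cocycles N' rho) (coboundaries N' rho).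
Proof.
move=> rhoN' fd.
have sZ := cocycles_subspace N' rho; have sZN := cocycles_subspace N rho.
have sB := coboundaries_subspace N' rho; have sBN := coboundaries_subspace N rho.
have sC := equivariant_subspace N rho.
pose U f := cocycles N' rho f /\ coboundaries N rho f.
have sU : subspace U.
  split=> [|a f h [Zf Bf] [Zh Bh]]; first by split; apply: subspace0.
  by split; [apply: sZ.2 | apply: sBN.2].
apply: (@findim_trans _ _ _ U) => // [f []//||].
  apply: (findim_relation (R := eq)) fd => // [a f h _ _ <- <- //|f Zf|f _ Zf <- //].
  by exists f => //; apply: cocycles_restrict Zf.
(* The dependence on the choice of [h] makes this a relation rather than a map. *)
apply: (findim_relation (R := fun f w => exists h,
  [/\ equivariant N rho h, f = coboundary h & w = translate (rho t) t h - h])) fd => //.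
- move=> a f f' w w' [h [Ch -> ->]] [h' [Ch' -> ->]].
  exists (a *: h + h'); split; first exact: sC.2; first by rewrite coboundary_lin.
  by rewrite translate_lin opprD addrACA scalerBr.
- move=> f [Zf [h Ch fh]]; exists (translate (rho t) t h - h); last by exists h.
  exact: cocycles_translate_sub1 Zf Ch fh.
- by move=> f w [Zf _] [h [Ch fh ->]]; apply: extend Zf Ch fh.
Qed.

Lemma jump_infinite_cyclic rho : jump N' rho -> jump N rho.
Proof.
move=> [rhoN' [f Zf nBf]]; split; first exact: character_on_sub rhoN'.
apply: contrapT => noN.
have Htriv h : cocycles N rho h -> coboundaries N rho h.
  by move=> Zh; apply: contrapT => nBh; apply: noN; exists h.
have [h Ch fh] := Htriv _ (cocycles_restrict NN' Zf).
by apply/nBf/(extend rhoN' Zf Ch fh)/Htriv/(cocycles_translate_sub1 rhoN' Zf Ch fh).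
Qed.

Lemma tame_infinite_cyclic : tame N -> tame N'.
Proof.
move=> [fd fin]; split=> [rho rhoN'|].
  by apply: findim_infinite_cyclic => //; apply/fd/character_on_sub/rhoN'.
have [N'1 [N'M N'V]] := sN'.
apply: (finite_on_extend (S := N) (ys := [:: t])).
- by have [L HL] := fin; exists L => rho /jump_infinite_cyclic; apply: HL.
- move=> _ /[!inE]/eqP-> sigma [sigN' _].
  have sigN := character_on_sub NN' sigN'.
  have sZ := cocycles_subspace N sigma; have sB := coboundaries_subspace N sigma.
  have EC f : equivariant N sigma f -> equivariant N sigma (translate 1 t f).
    exact: (equivariant_translate sN' NN' normN sigN').
  (* The untwisted translation is used: the operator and [p] then depend only on [sigma], and serve
     all [rho] agreeing with it on [N]. *)
  have [|||p [/finite_roots [r Hr] Hp]] :=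
    regular_mod_findim (T := translate 1 t) sZ sB _ _ _ (fd _ sigN).
  + exact: translate_lin.
  + move=> f [Cf df]; split; first exact: EC.
    by rewrite coboundary_translate df; apply/funext => s; rewrite /translate mulr0.
  + move=> _ [f Cf ->]; exists (translate 1 t f); first exact: EC.
    by rewrite coboundary_translate.
  exists [seq a^-1 | a <- r] => rho [rhoN' [f Zf nBf]] ars.
  rewrite -[rho t]invrK map_f //; apply: Hr; apply: contrapT => /negP /Hp [inj surj].
  have [rM r0] := rhoN'; have rt0 : rho t != 0 by apply: r0.
  have TE h : translate 1 t h - (rho t)^-1 *: h =
      (rho t)^-1 *: (translate (rho t) t h - h).
    rewrite scalerBr; congr (_ - _); apply/funext => s.
    by rewrite /translate mul1r; apply/esym/mulKf.
  have asr : agree N sigma rho by move=> x Nx; rewrite ars.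
  (* As [f] is fixed by the twisted translation, [translate 1 t - (rho t)^-1] kills it; injectivity
     makes it a coboundary over [N]. *)
  have [|h Ch fh] := inj f (eq_cocycles ars (cocycles_restrict NN' Zf)).
    rewrite TE (_ : _ - f = 0) ?scaler0; first exact: subspace0.
    apply/funext => s; rewrite !fctE /translate Zf.1.2; last exact: N'V.
    by rewrite (characterV sN' rhoN') // mulVKf ?subrr.
  have Ch' := eq_equivariant asr Ch.
  have Zw := cocycles_translate_sub1 rhoN' Zf Ch' fh.
  (* Surjectivity gives a cocycle [k] with the same obstruction class as [h], so that of [h - k]
     vanishes. *)
  have [|k Zk Bk] := surj (translate 1 t h - (rho t)^-1 *: h).
    by rewrite TE; apply: subspaceZ => //; apply: eq_cocycles Zw.
  apply: nBf; apply: (extend (h := h - k) rhoN' Zf).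
  + apply: subspaceB => //; first exact: equivariant_subspace.
    exact: (eq_cocycles asr Zk).1.
  + by rewrite coboundaryB Zk.2 subr0.
  apply: (eq_coboundaries asr); have := subspaceZ (rho t) sB Bk; congr coboundaries.
  rewrite !TE -scalerBr scalerA mulfV // scale1r.
  have -> : translate (rho t) t (h - k) = translate (rho t) t h - translate (rho t) t k.
    by apply/funext => s; rewrite !fctE /translate -mulrBr.
  by rewrite !opprD addrACA.
- move=> rho sigma [[rM r0] _] [[sM s0] _] ars art x N'x; have {}art := art t (mem_head _ _).
  have tp k : rho (gexpz t k) = sigma (gexpz t k).
    have tn n : rho (t ^+ n)%g = sigma (t ^+ n)%g.
      elim: n => [|n IH]; first exact/ars/sN.1.
      by rewrite expgS rM ?sM ?IH ?art //; apply: (gexpz_in sN' N't n).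
    case: k => n //=; rewrite (characterV sN') //; last exact: (gexpz_in sN' N't n.+1).
    by rewrite (characterV sN') ?tn //; apply: (gexpz_in sN' N't n.+1).
  have [k Nk] := quotN N'x.
  have -> : x = (gexpz t k * (gexpz t (- k) * x))%g by rewrite mulgA -gexpzD subrr /= mul1g.
  have tk := gexpz_in sN' N't k.
  have N'k := NN' Nk; by rewrite rM // tp (ars _ Nk) [RHS]sM.
Qed.

End InfiniteCyclicStep.

(** * Passage to an overgroup of finite index *)

Section FiniteIndexStep.
Variables (N N' : G -> Prop) (s : seq G).
Hypotheses (sN : is_subgroup N) (sN' : is_subgroup N').
Hypothesis (NN' : forall x, N x -> N' x).
Hypothesis (cover : forall x, N' x -> exists2 y, y \in s & N (y^-1 * x)%g).

(** The first entry of [s] in the left coset [x N]; taking the first makes it depend on that coset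
    only. *)
Let rep x := nth 1%g s (find (fun y => `[< N (y^-1 * x)%g >]) s).

Lemma repP x : N' x -> N ((rep x)^-1 * x)%g.
Proof.
move=> N'x; apply/asboolP; apply: (@nth_find _ _ (fun y => `[< N (y^-1 * x)%g >])).
by apply/hasP; have [y sy Ny] := cover N'x; exists y => //; apply/asboolP.
Qed.

Lemma eq_rep x y : N (y^-1 * x)%g -> rep x = rep y.
Proof.
have [_ [NM NV]] := sN; move=> Nyx; congr nth; apply: eq_find => z.
apply/asbool_equiv_eq; split=> Nz; last first.
  by have := NM _ _ Nz Nyx; rewrite mulgA mulgK.
by have := NM _ _ Nz (NV _ Nyx); rewrite invgM invgK mulgA mulgK.
Qed.

Lemma rep_in x : N' x -> N' (rep x).
Proof.
have [_ [N'M N'V]] := sN'; move=> N'x.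
have := N'M _ _ N'x (N'V _ (NN' (repP N'x))).
by rewrite invgM invgK mulVKg.
Qed.

(** Pigeonhole: among the powers of [y] with exponents from 0 to [size s], two lie in the same
    coset. *)
Lemma power_in y : N' y -> exists2 k, (0 < k)%N & N (y ^+ k)%g.
Proof.
move=> N'y; have [_ [NM NV]] := sN; have [N'1 [N'M N'V]] := sN'.
have yn n : N' (y ^+ n)%g by elim: n => [//|n IH]; rewrite expgS; apply: N'M.
pose c := [seq rep (y ^+ i)%g | i <- iota 0 (size s).+1].
have /(uniqPn 1%g) [i [j [ij]]] : ~~ uniq c.
  apply/negP => uc.
  suff : (size c <= size s)%N by rewrite size_map size_iota ltnn.
  apply: uniq_leq_size => // _ /mapP [i _ ->]; apply: mem_nth; rewrite -has_find.
  by apply/hasP; have [z sz Nz] := cover (yn i); exists z => //; apply/asboolP.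
rewrite size_map => js; rewrite size_iota in js.
rewrite !(nth_map 0%N) ?size_iota ?(ltn_trans ij) // !nth_iota ?(ltn_trans ij) //.
rewrite !add0n => e; exists (j - i)%N; first by rewrite subn_gt0.
have := NM _ _ (NV _ (repP (yn i))) (repP (yn j)).
by rewrite e invgM invgK -mulgA mulVKg -{1}(subnKC (ltnW ij)) expgnDr mulKg.
Qed.

(* Averaging over coset representatives, i.e. the transfer. *)
Lemma coboundaries_transfer rho f : character_on N' rho -> cocycles N' rho f ->
  coboundaries N rho f -> coboundaries N' rho f.
Proof.
move=> rhoN' [[f0 fN'] _] [h [h0 hN] fh].
have [rM r0] := rhoN'; have [N1 [NM NV]] := sN; have [N'1 [N'M N'V]] := sN'.
(* [S] holds exactly one representative for each coset of [N] in [N']. *)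
pose S := undup [seq rep y | y <- s & `[< N' y >]].
have repS x : N' x -> rep x \in S.
  move=> N'x; have [y sy Nyx] := cover N'x; rewrite mem_undup (eq_rep Nyx) map_f //.
  rewrite mem_filter sy andbT; apply/asboolP.
  have := N'M _ _ N'x (N'V _ (NN' Nyx)); by rewrite invgM invgK mulVKg.
have SP y : y \in S -> N' y /\ rep y = y.
  rewrite mem_undup => /mapP [x]; rewrite mem_filter => /andP[/asboolP N'x _] ->.
  by split; [apply: rep_in | rewrite -(eq_rep (repP N'x))].
have S0 : (size S)%:R != 0 :> K.
  by rewrite pnatr_eq0 size_eq0; apply: contraTneq (repS _ N'1) => ->.
have permS g : N' g -> perm_eq [seq rep (g * y)%g | y <- S] S.
  move=> N'g.
  have uS : uniq [seq rep (g * y)%g | y <- S].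
    rewrite map_inj_in_uniq ?undup_uniq // => x y /SP[N'x rx] /SP[N'y ry] e.
    rewrite -rx -ry; apply: eq_rep.
    have := NM _ _ (NV _ (repP (N'M _ _ N'g N'y))) (repP (N'M _ _ N'g N'x)).
    by rewrite e invgM invgK -mulgA mulVKg invgM -mulgA mulKg.
  have sub : {subset [seq rep (g * y)%g | y <- S] <= S}.
    by move=> _ /mapP [y /SP [N'y _] ->]; apply/repS/N'M.
  apply: uniq_perm => //; first exact: undup_uniq.
  by apply: (uniq_min_size uS sub _).2; rewrite size_map.
(* As [h] is [N]-equivariant, each summand depends only on the coset [y N], so left multiplication
   by [g] merely permutes the summands. *)
exists ((size S)%:R^-1 *: \sum_(y <- S) translate (rho y) y h).
  have sumE (v : seq G) : (\sum_(y <- S) translate (rho y) y h) v =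
      \sum_(y <- S) translate (rho y) y h v.
    by apply: (big_morph (fun F : seq G -> K^o => F v)).
  split=> [|g u N'g].
    by rewrite fctE sumE big1 ?scaler0 // => y _; rewrite /translate /= h0 mulr0.
  rewrite !fctE !sumE /GRing.scale /= mulrCA; congr (_ * _).
  rewrite -[in RHS](perm_big _ (permS _ (N'V _ N'g))) big_map mulr_sumr big_seq [RHS]big_seq.
  apply: eq_bigr => y /SP [N'y _].
  have N'gy := N'M _ _ (N'V _ N'g) N'y.
  set r := rep (g^-1 * y)%g; have N'r : N' r by apply: rep_in.
  pose n := (r^-1 * (g^-1 * y))%g; have Nn : N n by apply: repP.
  have yE : y = (g * (r * n))%g by rewrite /n !mulVKg.
  have ynE : (y * n^-1 = g * r)%g by rewrite /n !invgM !invgK -!mulgA mulVKg.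
  have rhoy : rho y = rho g * (rho r * rho n).
    by rewrite yE !rM //; auto.
  have Ey : [seq (y^-1 * x)%g | x <- [seq (g * x)%g | x <- u]] =
      [seq (n^-1 * x)%g | x <- [seq (r^-1 * x)%g | x <- u]].
    rewrite -!map_comp; apply: eq_map => x /=.
    by apply: (mulgI y); rewrite mulVKg !mulgA ynE mulgK.
  rewrite /translate Ey hN; last exact: NV.
  rewrite rhoy (characterV sN' rhoN'); last exact: NN'.
  by rewrite -!mulrA mulVKf ?r0 //; apply: NN'.
have cobsum (F : G -> seq G -> K^o) :
    coboundary (\sum_(y <- S) F y) = \sum_(y <- S) coboundary (F y).
  apply: (big_morph (@coboundary K G)); last exact: coboundary0.
  by move=> a b; rewrite -[a]scale1r coboundary_lin !scale1r.
rewrite -[_ *: _]addr0 coboundary_lin coboundary0 addr0 cobsum.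
have -> : \sum_(y <- S) coboundary (translate (rho y) y h) = (size S)%:R *: f.
  rewrite big_seq (eq_bigr (fun=> f)).
    by rewrite -big_seq big_const_seq count_predT iter_addr_0 scaler_nat.
  move=> y /SP[N'y _]; rewrite coboundary_translate -fh; apply/funext => u.
  by rewrite /translate fN' ?(characterV sN' rhoN') ?mulVKf ?r0 //; auto.
by rewrite scalerA mulVf // scale1r.
Qed.

Lemma tame_finite_index : tame N -> tame N'.
Proof.
move=> [fd fin]; have [N'1 [N'M N'V]] := sN'; split=> [rho rhoN'|].
  apply: (findim_relation (R := eq)) (fd _ (character_on_sub NN' rhoN')).
  - exact: cocycles_subspace.
  - exact: coboundaries_subspace.
  - exact: coboundaries_subspace.
  - by move=> a u v _ _ <- <-.
  - by move=> f Zf; exists f => //; apply: cocycles_restrict Zf.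
  - by move=> f _ Zf <-; apply: coboundaries_transfer.
apply: (finite_on_extend (S := N) (ys := [seq y <- s | `[< N' y >]])).
- have [L HL] := fin; exists L => rho [rhoN' [f Zf nBf]]; apply: HL; split.
    exact: character_on_sub rhoN'.
  exists f; first exact: cocycles_restrict Zf.
  by move=> Bf; apply/nBf/coboundaries_transfer.
- move=> y; rewrite mem_filter => /andP[/asboolP N'y _] sigma _.
  have [k k0 Nyk] := power_in N'y.
  (* The value of [rho] at [y] is a root of X^k - sigma(y^k), since [y ^+ k] lies in [N], where
     [rho] and [sigma] agree. *)
  have [r Hr] := finite_roots (monic_neq0 (monicXnsubC (sigma (y ^+ k)%g) k0)).
  exists r => rho [[rM r0] rj] ars; apply: Hr; rewrite /root !hornerE -ars // subr_eq0.
  apply/eqP; have yn n : N' (y ^+ n)%g by elim: n => [//|n IH]; rewrite expgS; apply: N'M.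
  elim: (k) => [|n IH]; first by rewrite expr0 (character1 sN').
  by rewrite exprS IH expgS rM.
- move=> rho sigma [[rM r0] _] [[sM s0] _] ars asy x N'x.
  have [y sy Nyx] := cover N'x.
  have N'y : N' y.
    by have := N'M _ _ N'x (N'V _ (NN' Nyx)); rewrite invgM invgK mulVKg.
  have N'z := NN' Nyx; have asy' : rho y = sigma y.
    by apply: asy; rewrite mem_filter sy andbT; apply/asboolP.
  by rewrite -(mulVKg y x) rM // (ars _ Nyx) asy' sM.
Qed.

End FiniteIndexStep.

Lemma tame_iff N N' : (forall x, N x <-> N' x) -> tame N -> tame N'.
Proof. by move=> NN'; rewrite (_ : N = N') //; apply/funext => x; apply/propext. Qed.

Lemma tame_polycyclic N : polycyclic N -> tame N.
Proof.
move=> [k [Hs [H0 [Hk [Hsub step]]]]].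
suff Htame j : (j <= k)%N -> tame (Hs (k - j)%N).
  by have := Htame k (leqnn k); rewrite subnn; apply: tame_iff.
(* The induction climbs from the trivial end of the series. *)
elim: j => [|j IH] jk; first by rewrite subn0; apply: tame_trivial.
have {IH} := IH (ltnW jk); set i := (k - j.+1)%N.
have -> : (k - j = i.+1)%N by rewrite /i -subSn ?subSS.
have ik : (i < k)%N by rewrite /i; case: (k) jk => // k' _; rewrite subSS ltnS leq_subr.
have [sub [nrm [g Hg quot]]] := step i ik.
have sN := Hsub _ ik; have sN' := Hsub _ (ltnW ik).
have [N1 [NM NV]] := sN.
(* Either [g] has finite order modulo the smaller term, giving finite index, or the quotient is
   infinite cyclic. *)
have [[n [n0 gn]]|inf] := pselect (exists n, (0 < n)%N /\ Hs i.+1 (g ^+ n)%g).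
  have gnq q : Hs i.+1 ((g ^+ n) ^+ q)%g by elim: q => [//|q IH]; rewrite expgS; apply: NM.
  have gE m : (g ^+ m = (g ^+ n) ^+ (m %/ n) * g ^+ (m %% n))%g.
    by rewrite -expgnA mulnC -expgnDr -divn_eq.
  (* Exponents are reduced modulo [n]; both signs are listed because an element may be reached by a
     positive or a negative power of [g]. *)
  apply: (@tame_finite_index _ _
    ([seq (g ^+ m)%g | m <- iota 0 n] ++ [seq (g ^- m)%g | m <- iota 0 n])) => //.
  move=> x /quot [m [Nx|Nx]].
    exists (g ^+ (m %% n))%g.
      by rewrite mem_cat map_f // mem_iota add0n ltn_mod.
    have := NM _ _ (gnq (m %/ n)%N) Nx.
    rewrite [(g ^+ m)%g]gE (commuteX2 _ _ _ : commute _ _) //.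
      by rewrite invgM mulgA mulVKg.
    by apply/commute_sym/commuteX/commute_refl.
  exists (g ^- (m %% n))%g.
    by rewrite mem_cat [X in _ || X]map_f ?orbT // mem_iota add0n ltn_mod.
  have := NM _ _ (NV _ (gnq (m %/ n)%N)) Nx.
  by rewrite [(g ^+ m)%g]gE -mulgA mulKg invgK.
apply: (@tame_infinite_cyclic _ _ g) => //.
  move=> x /quot [m [Nx|Nx]]; last by exists (- m%:Z); rewrite opprK.
  by exists m%:Z; case: m Nx => [|m] //; rewrite invg1.
have nz m : ~ Hs i.+1 (g ^+ m.+1)%g by move=> Ng; apply: inf; exists m.+1.
by move=> [[|m]|m] //= => [/nz|/NV]; rewrite ?invgK => // /nz.
Qed.

End Goodness.

(** * Comparison with the bar complex *)

Section BarComplex.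
Variable G : groupType.
Implicit Types (rho : G -> CC) (f k : seq G -> CC^o) (c w : chain G) (t u : seq G) (x y g : G).

Definition pairing f c : CC := \sum_(p <- c) p.1 * f p.2.

(** Grouping equal tuples expresses the pairing through the coefficient function, so a list
    representing the zero chain pairs to 0. *)
Lemma pairing_coef0 f c : (forall t, chain_coef c t = 0) -> pairing f c = 0.
Proof.
move=> c0; pose r := undup [seq p.2 | p <- c].
suff -> : pairing f c = \sum_(t <- r) chain_coef c t * f t.
  by rewrite big1 // => t _; rewrite c0 mul0r.
rewrite /pairing big_seq; under [RHS]eq_bigr do rewrite mulr_suml.
rewrite (exchange_big_dep predT) //= [RHS]big_seq; apply: eq_bigr => p cp.
have rp : p.2 \in r by rewrite mem_undup map_f.
rewrite -big_filter (_ : [seq t <- r | p.2 == t] = [:: p.2]) ?big_seq1 //.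
rewrite -(filter_pred1_uniq (undup_uniq _) rp); apply: eq_filter => t.
by rewrite /= eq_sym.
Qed.

Lemma pairing_bd rho f c :
  pairing f (bd rho c) = \sum_(p <- c) p.1 * pairing f (bd_gen rho p.2).
Proof.
rewrite /pairing /bd big_flatten big_map; apply: eq_bigr => p _.
by rewrite big_map mulr_sumr; apply: eq_bigr => q _; rewrite mulrA.
Qed.

Lemma chain_coef_pairing c t : chain_coef c t = pairing (fun u => (u == t)%:R) c.
Proof.
rewrite /chain_coef /pairing big_mkcond; apply: eq_bigr => p _.
by case: eqP => _; rewrite ?mulr1 ?mulr0.
Qed.

Lemma bd_gen_degree rho t : is_chain_of_degree (size t).-1 (bd_gen rho t).
Proof.
case: t => [//|g t]; rewrite /is_chain_of_degree /= eqxx all_cat /= andbT.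
rewrite size_takel ?leqnSn // eqxx andbT all_map; apply/allP => i.
rewrite mem_iota add1n ltnS => /andP[i0 it] /=.
rewrite /merge_at size_cat size_takel; last by case: (i) it => //= j /ltnW/leqW.
rewrite /= size_drop; apply/eqP; case: i i0 it => // i _ it /=.
by rewrite -addSnnS -[in RHS](subnKC it).
Qed.

(* All the faces of the inhomogeneous boundary of [g :: t] except the first one. *)
Fixpoint inner_faces g t f : CC :=
  if t is h :: t' then - f ((g * h)%g :: t') - inner_faces h t' (fun u => f (g :: u))
  else - f [::].

(** After the face that multiplies the first two entries, the remaining ones are those of the tail
    with [g] put back in front and the sign reversed. *)
Lemma pairing_bd_gen rho f g t :
  pairing f (bd_gen rho (g :: t)) = rho g * f t + inner_faces g t f.
Proof.
rewrite /pairing /bd_gen big_cons; congr (_ + _).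
elim: t g f => [|h t IH] g f.
  by rewrite /= big_seq1 expr1 mulN1r.
rewrite big_cat big_seq1 /= big_cons expr1 mulN1r -addrA; congr (- f _ + _).
  by rewrite /merge_at /= drop0.
rewrite -IH big_cat big_seq1 opprD /=; congr (_ + _); last by rewrite exprS mulN1r mulNr.
rewrite (iotaDl 1 1) !big_map -sumrN big_seq [RHS]big_seq.
apply: eq_bigr => i; rewrite mem_iota => /andP[i0 _] /=.
rewrite exprS mulN1r mulNr; congr (- (_ * f _)).
by case: i i0 => // i _; rewrite /merge_at /= add1n.
Qed.

Definition steps x u := pairmap (fun a b => a^-1 * b)%g x u.

(** The standard passage from bar cochains to equivariant homogeneous ones; [steps] recovers the bar
    entries as successive quotients. *)
Definition homogenize rho f : seq G -> CC^o :=
  fun s => if s is x :: u then rho x * f (steps x u) else 0.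

Lemma coboundary_steps f x y u : coboundary (fun v => f (steps x v)) (y :: u) =
  - inner_faces (x^-1 * y)%g (steps y u) f.
Proof.
elim: u x y f => [|z u IH] x y f; rewrite coboundary_cons.
  by rewrite /= opprK subr0.
have E : coboundary (fun v => f (steps x (y :: v))) (z :: u) =
    - inner_faces (y^-1 * z)%g (steps z u) (fun v => f ((x^-1 * y)%g :: v)).
  exact: (IH y z (fun v => f ((x^-1 * y)%g :: v))).
by rewrite E /= opprD !opprK -mulgA mulVKg.
Qed.

(** Deleting [x] gives the twisted first face, as [rho y = rho x * rho (x^-1 * y)]; each later
    deletion merges two steps or drops the last. *)
Lemma coboundary_homogenize rho f x y u : character rho ->
  coboundary (homogenize rho f) (x :: y :: u) =
  rho x * pairing f (bd_gen rho (steps x (y :: u))).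
Proof.
move=> [rM r0]; rewrite coboundary_cons.
have -> : coboundary (fun v => homogenize rho f (x :: v)) (y :: u) =
    rho x * coboundary (fun v => f (steps x v)) (y :: u).
  exact: (coboundaryZ (rho x) (fun v => f (steps x v))).
rewrite coboundary_steps /=.
by rewrite pairing_bd_gen mulrN opprK mulrDr mulrA -rM mulVKg.
Qed.

(** A functional vanishing on boundaries and equal to 1 on [z] gives a cocycle. Were it a
    coboundary, its value on [z] would be that of a cochain on the zero chain [bd rho z]. *)
Lemma homology_jump rho i : char_variety i 1 rho -> jump (K := CC) (fun=> True) rho.
Proof.
move=> [rho_char [[|z [|? ?]] [] //]] _ [/(_ 0%N isT) /= zi [/(_ 0%N isT) /= zcyc znb]].
have [rM r0] := rho_char; split; first by split=> // x y _ _; apply: rM.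
have r1 : rho 1%g = 1 by apply: (mulfI (r0 1%g)); rewrite -rM mul1g mulr1.
pose Bd (u : seq G -> CC^o) :=
  exists2 w : chain G, is_chain_of_degree i.+1 w & u = chain_coef (bd rho w).
have sB : subspace Bd.
  split=> [|a _ _ [w wi ->] [w' wi' ->]].
    by exists [::] => //; apply/funext => t; rewrite /chain_coef big_nil.
  exists ([seq (a * p.1, p.2) | p <- w] ++ w').
    by rewrite /is_chain_of_degree all_cat all_map; apply/andP.
  apply/funext => t; rewrite cochainE !chain_coef_pairing !pairing_bd big_cat big_map.
  by congr (_ + _); rewrite mulr_sumr; apply: eq_bigr => p _; rewrite mulrA.
have nBz : ~ Bd (chain_coef z).
  move=> [w wi zw]; have := znb (fun=> 1) w wi _ 0%N isT.
  have H : forall t, \sum_(j < 1) 1 * chain_coef (nth [::] [:: z] j) t =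
      chain_coef (bd rho w) t.
    by move=> t; rewrite big_ord1 mul1r /= zw.
  by move=> /(_ H) /eqP; rewrite oner_eq0.
have [phi [philin phiB phiz]] := separating_functional sB nBz.
pose delta t : seq G -> CC^o := fun u => (t == u)%:R.
pose f : seq G -> CC^o := fun t => if size t == i then phi (delta t) else 0.
have phi0 : phi 0 = 0 by have := philin (-1) 0 0; rewrite scaler0 addr0 mulN1r addNr.
have pairf c : is_chain_of_degree i c -> pairing f c = phi (chain_coef c).
  elim: c => [|p c IH].
    move=> _; rewrite /pairing big_nil (_ : chain_coef [::] = 0) ?phi0 //.
    by apply/funext => t; rewrite /chain_coef big_nil.
  move=> /andP[pi ci]; rewrite /pairing big_cons -/(pairing f c) IH // /f pi -philin.
  congr phi; apply/funext => t; rewrite cochainE !chain_coef_pairing /pairing.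
  by rewrite big_cons.
have f_bd t : pairing f (bd_gen rho t) = 0.
  have deg := bd_gen_degree rho t; have [ti|ni] := eqVneq (size t).-1 i; last first.
    rewrite /pairing big_seq big1 // => p /(allP deg) /eqP pt.
    by rewrite /f pt (negPf ni) mulr0.
  (* For [i = 0] the truncated predecessor also admits the empty tuple, whose boundary is empty. *)
  case: t => [|g t] in deg ti *; first by rewrite /pairing big_nil.
  rewrite pairf -?ti //; apply: phiB; exists [:: (1, g :: t)].
    by rewrite /is_chain_of_degree /= -ti eqxx.
  apply/funext => u; rewrite !chain_coef_pairing pairing_bd big_seq1 mul1r.
  by [].
exists (homogenize rho f).
  split; last first.
    apply/funext => -[|x [|y u]] //; first by rewrite coboundary_cons /= subr0.
    by rewrite coboundary_homogenize // f_bd mulr0.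
  split=> // g [|x u] _; first by rewrite /= mulr0.
  rewrite /= rM -mulrA; congr (_ * (_ * f _)).
  elim: u x => //= y u IH x; rewrite IH; congr (_ :: _).
  by rewrite invgM -mulgA mulKg.
move=> [h [h0 hG] fh].
(* Inverse of homogenization: [h] is evaluated at 1 followed by the partial products of the bar
   entries. *)
pose k : seq G -> CC^o := fun t => h (1%g :: scanl (fun a b => a * b)%g 1%g t).
have scan_steps a x u :
    scanl (fun a b => a * b)%g a (steps x u) = [seq (a * x^-1 * y)%g | y <- u].
  elim: u a x => //= y u IH a x; rewrite IH !mulgA; congr (_ :: _).
  by apply: eq_map => v; rewrite mulgK.
have hE : h = homogenize rho k.
  apply/funext => -[//|x u]; rewrite /= /k scan_steps -hG //=.
  rewrite mulg1 -map_comp map_id_in // => y _ /=.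
  by rewrite mul1g mulVKg.
have stepsK t : steps 1%g (scanl (fun a b => a * b)%g 1%g t) = t.
  by apply: scanlK => x y; rewrite mulKg.
have fE t : f t = pairing k (bd_gen rho t).
  have := congr1 (fun F => F (1%g :: scanl (fun a b => a * b)%g 1%g t)) fh.
  rewrite {1}/homogenize r1 mul1r stepsK => ->; rewrite hE.
  case: t => [|g t]; first by rewrite coboundary_cons /= subr0 /pairing big_nil.
  by rewrite coboundary_homogenize // r1 mul1r (stepsK (g :: t)).
have := pairf z zi; rewrite phiz => fz1.
have := oner_eq0 CC; rewrite -fz1 /pairing; under eq_bigr do rewrite fE.
by rewrite -pairing_bd pairing_coef0 // eqxx.
Qed.

End BarComplex.

Theorem theorem3p5 (G : groupType) :
  virtually_polycyclic G ->
  forall i : nat,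
    exists s : list (G -> CC),
      forall rho : G -> CC, char_variety i 1 rho ->
        exists2 sigma, List.In sigma s & forall g, rho g = sigma g.
Proof.
move=> [H [sH [[s fins] pH]]] i.
have sG : is_subgroup (fun _ : G => True) by [].
have [_ [L HL]] := tame_finite_index sH sG (fun _ _ => I) (fun x _ => fins x)
  (tame_polycyclic CC pH).
(* [L] serves every [i], since a jump records non-vanishing in any degree. *)
exists L => rho /homology_jump /HL [sigma Ls e]; exists sigma => // g; exact: e.
Qed.
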